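(* Let $H\colon\mathbb T\to[0,+\infty]$ be a lower semicontinuous function with $\int_{\mathbb T}H\,dm=+\infty$, and suppose that for every $C>0$ the equation $C\lambda_H^*(A)=A$ has a unique solution $A>0$. Let $\rho$ be a finite positive measure on $\mathbb T$ with $\int_{\mathbb T}e^H\,d\rho<\infty$. For each $n\ge1$ let $A(n)$ be the solution of $n\lambda_H^*(A)=A$. Then there exist $c>0$ and $n_0$, not depending on $n$, such that for all $n\ge n_0$ $$|\log e_n(\rho)|\ge c\,A(n)\,\lambda_H^*(A(n)).$$
   Context: $\mathbb T$ is the unit circle and $m$ is Lebesgue measure on $\mathbb T$ normalized by $m(\mathbb T)=1$. For a finite positive measure $\rho$ on $\mathbb T$, $e_n(\rho)=\min_{q_0,\dots,q_{n-1}\in\mathbb C}\Bigl(\int_{\mathbb T}|q_0+q_1t+\dots+q_{n-1}t^{n-1}+t^n|^2\,d\rho(t)\Bigr)^{1/2}$. Conventions: $|\log 0|=+\infty$, $e^{+\infty}=+\infty$. For $a\ge 0$ the set $\{H>a\}$ is open, and $\lambda_H^*(a)$ denotes the length (with respect to $m$, so that the whole circle has length $1$) of the longest open interval (arc) contained in $\{H>a\}$. *)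

(* Defs.v *)
From HB Require Import structures.
From mathcomp Require Import all_boot all_order all_algebra.
From mathcomp Require Import complex.
From mathcomp Require Import all_classical all_reals all_analysis measurable_realfun.
Set Implicit Arguments.
Unset Strict Implicit.
Unset Printing Implicit Defensive.
Import Order.TTheory GRing.Theory Num.Theory.
Import numFieldNormedType.Exports.
Local Open Scope classical_set_scope.
Local Open Scope ring_scope.

(* [R[i]^o] rather than [R[i]]: it is [_^o] that carries the topology of the
   modulus. As a [set_type], the circle receives the induced topology. *)
Definition circle (R : realType) : Type :=
  set_type [set z : R[i]^o | `|z| = 1].

Definition circle_val (R : realType) (t : circle R) : R[i] := \val t.

Lemma norm_expi (R : realType) (x : R) :
  ((cos (2 * pi * x) +i* sin (2 * pi * x))%C : R[i]^o)
    \in [set z : R[i]^o | `|z| = 1].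
Proof. by apply/mem_set => /=; rewrite normc_def/= cos2Dsin2 sqrtr1. Qed.

(* x |-> exp (2 i pi x) *)
Definition expi (R : realType) (x : R) : circle R :=
  exist (fun z => z \in [set z : R[i]^o | `|z| = 1]) _ (norm_expi x).

Section circle_structures.
Variable R : realType.

HB.instance Definition _ := Topological.on (circle R).

HB.instance Definition _ := isPointed.Build (circle R) (expi 0).

HB.instance Definition _ := Measurable.copy (circle R)
  (g_sigma_algebraType (@open (circle R))).

Lemma continuous_expi : continuous (@expi R).
Proof.
apply: continuous_comp_initial => x U /= [e /= e0 eU].
have [e' e'0 ee'] : exists2 e' : R, 0 < e' & e = e'%:C%C.
  move: e0; case: (e) => a b; rewrite ltcE/= => /andP[/eqP -> a0].
  by exists a.
rewrite {}ee' in eU.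
have c : {for x, continuous (fun y : R => cos (2 * pi * y))}.
  apply: continuous_comp; last exact: continuous_cos.
  exact: mulrl_continuous.
have s : {for x, continuous (fun y : R => sin (2 * pi * y))}.
  apply: continuous_comp; last exact: continuous_sin.
  exact: mulrl_continuous.
have e'2 : 0 < e' / 2 by rewrite divr_gt0.
move/cvgrPdist_lt : c => /(_ _ e'2) c.
move/cvgrPdist_lt : s => /(_ _ e'2) s.
apply: (filterS2 _ _ c s) => y /= cy sy.
apply: eU => /=.
set z := (X in `|X| < _).
have -> : z = ((cos (2 * pi * x) - cos (2 * pi * y))%:C +
              'i * (sin (2 * pi * x) - sin (2 * pi * y))%:C)%C.
  by rewrite /z; simpc.
apply: le_lt_trans (ler_normD _ _) _.
rewrite normrM !normc_def/= !expr0n/= expr1n add0r !addr0 sqrtr1 mul1r.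
rewrite !sqrtr_sqr -rmorphD/= ltcR.
by rewrite [e']splitr ltrD.
Qed.

Lemma measurable_expi :
  measurable_fun setT (@expi R : measurableTypeR R -> circle R).
Proof.
apply: (measurability (@open (circle R))) => //.
move=> _ [U oU <-]; rewrite setTI; apply: open_measurable.
by move/continuousP : continuous_expi; exact.
Qed.

(* Lebesgue measure, normalized to have mass 1 *)
Definition circle_leb : set (circle R) -> \bar R :=
  pushforward (mrestr (@lebesgue_measure R) (measurable_itv `[0, 1[))
    (@expi R : measurableTypeR R -> circle R).

Let circle_leb0 : circle_leb set0 = 0%E.
Proof. by rewrite /circle_leb /pushforward preimage_set0 measure0. Qed.

Let circle_leb_ge0 A : (0 <= circle_leb A)%E.
Proof. by rewrite /circle_leb /pushforward measure_ge0. Qed.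

Let circle_leb_sigma_additive : semi_sigma_additive circle_leb.
Proof.
move=> F mF tF mUF; rewrite /circle_leb /pushforward preimage_bigcup.
have mE n : measurable ((@expi R : measurableTypeR R -> circle R) @^-1` F n).
  by rewrite -[X in measurable X]setTI; exact: measurable_expi.
apply: measure_semi_sigma_additive => //.
- apply/trivIsetP => /= i j _ _ ij; rewrite -preimage_setI.
  by move/trivIsetP : tF => /(_ _ _ _ _ ij) ->//; rewrite preimage_set0.
- exact: bigcup_measurable.
Qed.

HB.instance Definition _ := isMeasure.Build _ _ _ circle_leb
  circle_leb0 circle_leb_ge0 circle_leb_sigma_additive.

Lemma circle_lebT : circle_leb setT = 1%E.
Proof.
rewrite /circle_leb /pushforward preimage_setT /mrestr setTI.
by rewrite lebesgue_measure_itv/= lte_fin ltr01 oppr0 adde0.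
Qed.

End circle_structures.

(* The bounds are not normalized: the arc is the whole circle when
   [b - a > 1], and it is empty when [b <= a]. *)
Definition open_arc (R : realType) (I : set (circle R)) : Prop :=
  exists a b : R, I = @expi R @` `]a, b[.

(* The length of the longest open arc contained in {H > a}; 0 if {H > a} is
   empty. *)
Definition longest_arc (R : realType) (H : circle R -> \bar R) (a : R) : R :=
  fine (ereal_sup [set circle_leb I | I in
    [set I | open_arc I /\ I `<=` [set t | (a%:E < H t)%E]]]).

(* e_n(rho); the infimum is attained (least squares in the finite-dimensional
   space of polynomials of degree less than n) *)
Definition szego_min (R : realType)
    (rho : {finite_measure set (circle R) -> \bar R}) (n : nat) : \bar R :=
  ereal_inf (range (fun q : 'I_n -> R[i] =>
    ((\int[rho]_t (Normc.normc (\sum_(k < n) q k * circle_val t ^+ k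
                                + circle_val t ^+ n) ^+ 2)%:E) `^ 2^-1)%E)).

(* Main.v *)
Require Import Defs.
From mathcomp Require Import all_boot all_order all_algebra.
From mathcomp Require Import complex ring lra zify.
From mathcomp Require Import all_classical all_reals all_analysis measurable_realfun.
Import Order.TTheory GRing.Theory Num.Theory.
Import numFieldNormedType.Exports.
Import Normc.
Set Implicit Arguments.
Unset Strict Implicit.
Unset Printing Implicit Defensive.
Local Open Scope classical_set_scope.
Local Open Scope ring_scope.
Local Open Scope complex_scope.

(** The quantity [e_n(rho) ^ 2] is at most the integral of [|p| ^ 2] for any monic
    [p] of degree [n]. If [|p| ^ 2 <= a + b * exp H] on the circle, the integral is
    at most [a * rho T + b * K], where [K] is the integral of [exp H]
    ([abs_lne_szego_min_ge]); so it suffices to exhibit good polynomials. Put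
    [A = A(n)] and [L = A / n], the length of the longest arc in [{H > A}].

    If [A * L] is large, take for [p] the Chebyshev polynomial of the complement of
    an arc of length [L / 8] contained in [{H > A}] ([exists_arc_poly]). Off this
    small arc [|p| ^ 2] is at most [4 * exp (- n L^2 / 256)], that is
    [4 * exp (- A L / 256)]. On the arc it is at most [4 * exp (A / 2)], which is
    compensated by [exp H > exp A]. This gives [|log e_n| >= A L / 1024]
    ([abs_lne_szego_min_ge_arc]).

    If [A * L] stays below a fixed bound, it is enough that [e_n] is eventually at
    most a constant smaller than 1. This is the easy half of the theorem of Szego:
    since the integral of [H] diverges, there is a Lipschitz function [g <= H] with
    a mean as large as desired, and [exp (g - mean)] is nearly the squared modulus
    of a monic polynomial. The function [g] is an infimal convolution of a
    truncation of [H] with a multiple of the distance ([lipschitz_env]). A Fejer sum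
    of [g] at roots of unity is [mean + 2 Re h] with [h] a polynomial in [1 / t]
    without constant term, and [(t^m (1 + h / l))^l] is the required polynomial for
    [l] large ([exists_monic_le_exp]). As [e_n] does not increase with [n], one
    polynomial settles all larger degrees ([abs_lne_szego_min_ge_half]). *)

(** * Trigonometry and parametrization of the unit circle *)

Section trigonometry.
Variable R : realType.
Implicit Types a b u x : R.

Lemma sin_sub_le a b : `|sin a - sin b| <= `|a - b|.
Proof.
wlog ab : a b / b <= a.
  move=> h; have [/h //|/ltW/h] := leP b a.
  by rewrite distrC [`|b - a|]distrC.
have [|c _ ->] := @MVT_segment R sin cos b a ab.
  by apply/continuous_subspaceT => x; exact: continuous_sin.
by rewrite normrM ler_piMl// cos_max.
Qed.

Lemma cos_sub_le a b : `|cos a - cos b| <= `|a - b|.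
Proof.
have h x : cos x = sin (x + pi / 2) by rewrite sinDpihalf.
rewrite !h (le_trans (sin_sub_le _ _))//.
by have -> : a + pi / 2 - (b + pi / 2) = a - b by ring.
Qed.

Lemma sin_le_id u : 0 <= u -> sin u <= u.
Proof.
move=> u0; have := sin_sub_le u 0; rewrite sin0 !subr0 (ger0_norm u0).
by apply: le_trans; exact: ler_norm.
Qed.

Lemma sin_ge_half u : 0 <= u -> u <= 2^-1 -> u / 2 <= sin u.
Proof.
move=> u0 u1.
have [|c /[!in_itv]/= /andP[c0 cu]] := @MVT_segment R sin cos 0 u u0.
  by apply/continuous_subspaceT => x; exact: continuous_sin.
rewrite sin0 !subr0 => ->; rewrite mulrC ler_wpM2r//.
have := cos_sub_le 0 c; rewrite cos0 sub0r normrN (ger0_norm c0).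
by have := ler_norm (1 - cos c); lra.
Qed.
End trigonometry.

Section modulus.
Variable R : realType.
Implicit Types z w : R[i].

Lemma sqr_normcE z : normc z ^+ 2 = complex.Re z ^+ 2 + complex.Im z ^+ 2.
Proof. by case: z => a b /=; rewrite sqr_sqrtr// addr_ge0// sqr_ge0. Qed.

Lemma normc_ge0 z : 0 <= normc z.
Proof. by case: z => a b; exact: sqrtr_ge0. Qed.

Lemma normcX z n : normc (z ^+ n) = normc z ^+ n.
Proof.
elim: n => [|n ih]; first by rewrite !expr0 normc1.
by rewrite !exprS normcM ih.
Qed.

Lemma normcD z w : normc (z + w) <= normc z + normc w.
Proof. exact: le_normcD. Qed.

Lemma normc_opp z : normc (- z) = normc z.
Proof. exact: normcN. Qed.

Lemma normc_sum (I : Type) (s : seq I) (F : I -> R[i]) :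
  normc (\sum_(i <- s) F i) <= \sum_(i <- s) normc (F i).
Proof.
elim/big_ind2 : _ => //; first by rewrite normc0.
by move=> x1 x2 y1 y2 h1 h2; rewrite (le_trans (normcD _ _))// lerD.
Qed.

Lemma normc_real (r : R) : normc r%:C = `|r|.
Proof. by rewrite /= expr0n/= addr0 sqrtr_sqr. Qed.

Lemma normc_conj z : normc (z^*)%C = normc z.
Proof. by case: z => a b /=; rewrite sqrrN. Qed.

Lemma mul_conjc z : z * (z^*)%C = (normc z ^+ 2)%:C.
Proof.
rewrite sqr_normcE; case: z => a b /=; rewrite /conjc; simpc.
by rewrite -!expr2 addrC; congr (_ +i* _); ring.
Qed.

Lemma normc_Re z : `|complex.Re z| <= normc z.
Proof.
rewrite -(@ler_pXn2r _ 2)// ?nnegrE ?normc_ge0// sqr_normcE.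
by rewrite real_normK ?num_real// lerDl sqr_ge0.
Qed.

Lemma normc_Im z : `|complex.Im z| <= normc z.
Proof.
rewrite -(@ler_pXn2r _ 2)// ?nnegrE ?normc_ge0// sqr_normcE.
by rewrite real_normK ?num_real// lerDr sqr_ge0.
Qed.

Lemma normc_le_ReIm z : normc z <= `|complex.Re z| + `|complex.Im z|.
Proof.
rewrite -(@ler_pXn2r _ 2)// ?nnegrE ?normc_ge0 ?addr_ge0// sqr_normcE.
rewrite sqrrD !real_normK ?num_real// lerD2r lerDl.
by rewrite mulrn_wge0// mulr_ge0.
Qed.

Lemma sqr_normc_1D z : normc (1 + z) ^+ 2 = 1 + 2 * complex.Re z + normc z ^+ 2.
Proof. by rewrite !sqr_normcE; case: z => a b /=; ring. Qed.

End modulus.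

Section unit_circle.
Variable R : realType.
Implicit Types u v x y : R.

(** [cis u] is exp (i u). *)
Definition cis u : R[i] := cos u +i* sin u.

Lemma cisD u v : cis (u + v) = cis u * cis v.
Proof. by rewrite /cis cosD sinD; simpc; rewrite [sin u * cos v + _]addrC. Qed.

Lemma cis0 : cis 0 = 1.
Proof. by rewrite /cis cos0 sin0. Qed.

Lemma normc_cis u : normc (cis u) = 1.
Proof. by rewrite /= cos2Dsin2 sqrtr1. Qed.

Lemma conj_cis u : ((cis u)^*)%C = cis (- u).
Proof. by rewrite /cis cosN sinN. Qed.

Lemma cis_nat u n : cis (u * n%:R) = cis u ^+ n.
Proof.
elim: n => [|n ih]; first by rewrite mulr0 cis0 expr0.
by rewrite -natr1 mulrDr mulr1 cisD ih exprSr.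
Qed.

Lemma cis_2pi : cis (2 * pi) = 1.
Proof. by rewrite mulr_natl /cis cos2pi sin2pi. Qed.

Lemma cis_2pi_int (k : int) : cis (2 * pi * k%:~R) = 1.
Proof.
case: k => n; first by rewrite cis_nat cis_2pi expr1n.
by rewrite NegzE mulrNz mulrN -conj_cis cis_nat cis_2pi expr1n conjc1.
Qed.

Lemma circle_valE x : circle_val (expi x) = cis (2 * pi * x).
Proof. by []. Qed.

Lemma circle_val_inj : injective (@circle_val R).
Proof. exact: val_inj. Qed.

Lemma normc_circle (t : circle R) : normc (circle_val t) = 1.
Proof.
have : `|circle_val t : R[i]^o| = 1.
  by case: t => z zP; move/set_mem : (zP).
rewrite /circle_val; case: (val t) => a b /=; rewrite normc_def/=.
by move=> /(congr1 (@complex.Re R)).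
Qed.

Lemma expi_int x (k : int) : expi (x + k%:~R) = expi x.
Proof.
by apply: circle_val_inj; rewrite !circle_valE mulrDr cisD cis_2pi_int mulr1.
Qed.

Lemma expi_surj (t : circle R) : exists x, t = expi x.
Proof.
have := normc_circle t; case E : (circle_val t) => [a b] /= h.
have ab : a ^+ 2 + b ^+ 2 = 1.
  by rewrite -[LHS]sqr_sqrtr ?h ?expr1n// addr_ge0// sqr_ge0.
have b2 := sqr_ge0 b.
have a1 : -1 <= a <= 1 by nra.
have pi2 : 2 * pi != 0 :> R by rewrite mulf_neq0// gt_eqF// pi_gt0.
have sE : sin (acos a) ^+ 2 = b ^+ 2.
  by rewrite sin2cos2 acosK// -ab [LHS]addrAC subrr add0r.
have K u : 2 * pi * (u / (2 * pi)) = u by rewrite mulrC divfK.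
have /orP[/eqP sb|/eqP sb] : (sin (acos a) == b) || (sin (acos a) == - b).
  by rewrite -eqf_sqr sE.
- exists (acos a / (2 * pi)); apply: circle_val_inj.
  by rewrite circle_valE K E /cis acosK// sb.
- exists (- acos a / (2 * pi)); apply: circle_val_inj.
  by rewrite circle_valE K E /cis cosN sinN acosK// sb opprK.
Qed.

Lemma expi_surj_itv (m : R) (t : circle R) :
  exists2 x, t = expi x & m - 2^-1 <= x < m + 2^-1.
Proof.
have [x ->] := expi_surj t.
pose k := Num.floor (x - (m - 2^-1)).
exists (x + (- k)%:~R); first by rewrite expi_int.
have /andP[k1 k2] := floor_itv (x - (m - 2^-1)).
move: k1 k2; rewrite -/k intrD rmorphN/= => k1 k2.
by apply/andP; split; lra.
Qed.

(** [expi] has minimal period 1. *)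
Lemma expi_inj_lt1 x y : `|x - y| < 1 -> expi x = expi y -> x = y.
Proof.
move=> xy1 /(congr1 (@circle_val R)); rewrite !circle_valE => e.
have c1 : cis (2 * pi * (x - y)) = 1.
  rewrite mulrBr cisD e -conj_cis mul_conjc normc_cis expr1n//.
apply/eqP; rewrite -subr_eq0; apply/eqP.
move: (x - y) xy1 c1 => d d1 [c1 _] {e x y}.
have {c1} s0 : sin (pi * d) = 0.
  have : 2 * pi * d = pi * d + pi * d by ring.
  move=> e; move: c1; rewrite e cosD -!expr2 => h.
  have := cos2Dsin2 (pi * d) => h2.
  by apply/eqP; rewrite -sqrf_eq0; apply/eqP; lra.
have pi0 := pi_gt0 R.
wlog d0 : d d1 s0 / 0 <= d.
  move=> h; have [/h|/ltW dn] := leP 0 d; first exact.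
  have : - d = 0 by apply: h; rewrite ?normrN ?mulrN ?sinN ?s0 ?oppr0// oppr_ge0.
  by move/eqP; rewrite oppr_eq0 => /eqP.
move: d0; rewrite le_eqVlt => /predU1P[//|d0].
suff : 0 < sin (pi * d) by rewrite s0 ltxx.
apply: sin_gt0_pi; rewrite mulr_gt0//= -[ltRHS]mulr1 ltr_pM2l//.
by rewrite (le_lt_trans (ler_norm _)).
Qed.

(** The constant 16 is not optimal: [2 pi] is the Lipschitz constant of [expi]. *)
Lemma expi_chord_le x y :
  normc (circle_val (expi x) - circle_val (expi y)) <= 16 * `|x - y|.
Proof.
rewrite !circle_valE (le_trans (normc_le_ReIm _))//=.
have h : `|2 * pi * x - 2 * pi * y| <= 8 * `|x - y|.
  rewrite -mulrBr normrM ler_wpM2r// ger0_norm ?mulr_ge0 ?pi_ge0//.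
  have := @pihalf_lt2 R; lra.
have := cos_sub_le (2 * pi * x) (2 * pi * y).
have := sin_sub_le (2 * pi * x) (2 * pi * y).
lra.
Qed.

End unit_circle.

(** * Measurability and the extremal problem *)

Section circle_measurability.
Variable R : realType.
Implicit Types (t s : circle R) (p : {poly R[i]}).

(** Neighbourhoods in the circle are described by chord lengths. *)
Lemma nbhs_circleP t (V : set (circle R)) :
  nbhs t V <-> exists2 e : R, 0 < e &
    forall s, normc (circle_val s - circle_val t) < e -> V s.
Proof.
have nE (z w : R[i]^o) : `|z - w| = (normc (w - z))%:C.
  by rewrite distrC; case: (w - z) => a b; rewrite normc_def.
split.
  move=> [_ [[B oB <-] Bt BV]].
  have /nbhs_ballP[e /= e0 eB] : nbhs (\val t : R[i]^o) B.
    exact: open_nbhs_nbhs.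
  move: e e0 eB => [e e'] /= /andP[/eqP -> e0] eB.
  exists e => // s st; apply: BV; apply: eB.
  by rewrite -ball_normE/= nE ltcR.
move=> [e e0 eV].
exists (\val @^-1` ball (circle_val t : R[i]^o) e%:C); split.
- by exists (ball (circle_val t : R[i]^o) e%:C) => //; apply: ball_open; rewrite ltcR.
- by apply: ballxx; rewrite ltcR.
- by move=> s /=; rewrite -ball_normE/= nE ltcR; exact: eV.
Qed.

Lemma lsc_measurable (f : circle R -> \bar R) :
  lower_semicontinuous f -> measurable_fun setT f.
Proof.
move=> /lower_semicontinuousP scf.
apply: (measurability _ (ErealGenOInfty.measurableE R)).
move=> /= _ [_ [a ->]] <-; rewrite setTI preimage_itvoy.
by apply: sub_sigma_algebra; exact: scf.
Qed.

Lemma lsc_expeR (f : circle R -> \bar R) : (forall t, (0 <= f t)%E) ->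
  lower_semicontinuous f -> lower_semicontinuous (fun t => expeR (f t)).
Proof.
move=> f0 lscf t a aft; have [a0|a0] := leP a 0.
  exists setT => [|s _]; first exact: filterT.
  rewrite (@le_lt_trans _ _ 0%E) ?lee_fin// expeR_gt0//.
  by rewrite (lt_le_trans _ (f0 s))// ltNye.
have aE : (a%:E = expeR (ln a)%:E)%E by rewrite /= lnK.
have [|V tV Vf] := lscf t (ln a); first by rewrite -lte_expeR -aE.
by exists V => // s /Vf; rewrite aE lte_expeR.
Qed.

Lemma lipschitz_measurable (K : R) (f : circle R -> R) : 0 < K ->
  (forall s t, f t - f s <= K * normc (circle_val s - circle_val t)) ->
  measurable_fun setT f.
Proof.
move=> K0 fK; apply/measurable_EFinP; apply: lsc_measurable => t a.
rewrite lte_fin => aft.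
exists [set s | a < f s] => //.
apply/nbhs_circleP; exists ((f t - a) / K); first by rewrite divr_gt0// subr_gt0.
move=> s; rewrite ltr_pdivlMr// mulrC => /(le_lt_trans (fK s t)) /=; lra.
Qed.

Lemma measurable_circle_poly p :
  measurable_fun setT (fun t => complex.Re p.[circle_val t]) /\
  measurable_fun setT (fun t => complex.Im p.[circle_val t]).
Proof.
have mRe : measurable_fun setT (fun t => complex.Re (circle_val t)).
  apply: (@lipschitz_measurable 1) => // s t; rewrite mul1r -[normc _]normc_opp opprB.
  apply: le_trans (normc_Re _); case: (circle_val t) => a b.
  by case: (circle_val s) => c d; exact: ler_norm.
have mIm : measurable_fun setT (fun t => complex.Im (circle_val t)).
  apply: (@lipschitz_measurable 1) => // s t; rewrite mul1r -[normc _]normc_opp opprB.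
  apply: le_trans (normc_Im _); case: (circle_val t) => a b.
  by case: (circle_val s) => c d; exact: ler_norm.
elim/poly_ind : p => [|p c [ihr ihi]].
  by split; under eq_fun do rewrite horner0; exact: measurable_cst.
split.
- rewrite [X in measurable_fun _ X](_ : _ = fun t =>
    (complex.Re p.[circle_val t] * complex.Re (circle_val t)
     - complex.Im p.[circle_val t] * complex.Im (circle_val t)) + complex.Re c).
    apply: measurable_funD; last exact: measurable_cst.
    by apply: measurable_funB; exact: measurable_funM.
  apply/funext => t; rewrite hornerMXaddC.
  by case: (circle_val t) (p.[_]) c => [? ?] [? ?] [? ?].
- rewrite [X in measurable_fun _ X](_ : _ = fun t =>
    (complex.Re p.[circle_val t] * complex.Im (circle_val t)
     + complex.Im p.[circle_val t] * complex.Re (circle_val t)) + complex.Im c).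
    apply: measurable_funD; last exact: measurable_cst.
    by apply: measurable_funD; exact: measurable_funM.
  apply/funext => t; rewrite hornerMXaddC.
  by case: (circle_val t) (p.[_]) c => [? ?] [? ?] [? ?].
Qed.

Lemma measurable_sqr_normc_poly p :
  measurable_fun setT (fun t => normc p.[circle_val t] ^+ 2).
Proof.
have [mr mi] := measurable_circle_poly p.
under eq_fun do rewrite sqr_normcE !expr2.
by apply: measurable_funD; exact: measurable_funM.
Qed.

End circle_measurability.

Section extremal_problem.
Variables (R : realType) (rho : {finite_measure set (circle R) -> \bar R}).

Lemma szego_min_le_monic n (p : {poly R[i]}) : p \is monic -> size p = n.+1 ->
  (szego_min rho n <=
   (\int[rho]_t (normc p.[circle_val t] ^+ 2)%:E) `^ 2^-1)%E.
Proof.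
move=> pm sp; apply: ge_ereal_inf.
exists ((\int[rho]_t (normc p.[circle_val t] ^+ 2)%:E) `^ 2^-1)%E => //.
exists (fun k : 'I_n => p`_k) => //.
congr ((integral _ _ _) `^ _)%E; apply/funext => t.
rewrite horner_coef sp big_ord_recr/=.
by move/monicP : pm; rewrite lead_coefE sp/= => ->; rewrite mul1r.
Qed.

(** A monic polynomial of degree [n] whose squared modulus is at most
    [a + b * exp H] bounds [e_n]; here [e_n <= exp (- y)]. *)
Lemma abs_lne_szego_min_ge (H : circle R -> \bar R) n (p : {poly R[i]}) (a b y : R) :
  (forall t, (0 <= H t)%E) -> lower_semicontinuous H ->
  p \is monic -> size p = n.+1 -> 0 <= a -> 0 <= b -> 0 <= y ->
  (forall t, ((normc p.[circle_val t] ^+ 2)%:E <= a%:E + b%:E * expeR (H t))%E) ->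
  (a%:E * rho setT + b%:E * \int[rho]_t expeR (H t) <= (expR (- (2 * y)))%:E)%E ->
  (y%:E <= `| lne (szego_min rho n)|)%E.
Proof.
move=> H0 Hlsc pm sp a0 b0 y0 pH hy.
have mH : measurable_fun setT (fun t => expeR (H t)).
  by apply: lsc_measurable; exact: lsc_expeR.
have int_le : (\int[rho]_t (normc p.[circle_val t] ^+ 2)%:E
    <= (expR (- (2 * y)))%:E)%E.
  apply: le_trans hy.
  rewrite -ge0_integralZl//; last by move=> t _; exact: expeR_ge0.
  rewrite -[X in (_ <= X + _)%E]integral_cst// -ge0_integralD//.
  - apply: ge0_le_integral => //.
    + by move=> t _; rewrite lee_fin sqr_ge0.
    + by apply/measurable_EFinP; exact: measurable_sqr_normc_poly.
    + apply: emeasurable_funD => //; exact: measurable_funeM.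
  - by move=> t _; rewrite mule_ge0// ?expeR_ge0// lee_fin.
  - exact: measurable_funeM.
have le_exp : (szego_min rho n <= (expR (- y))%:E)%E.
  apply: (le_trans (szego_min_le_monic pm sp)).
  have -> : (expR (- y))%:E = ((expR (- (2 * y)))%:E `^ 2^-1)%E :> \bar R.
    rewrite poweR_EFin -expRM; congr (expR _)%:E; by field.
  apply: gt0_ler_poweR => //.
  - by rewrite in_itv/= leey andbT integral_ge0// => t _; rewrite lee_fin sqr_ge0.
  - by rewrite in_itv/= leey andbT lee_fin expR_ge0.
have sz0 : (0 <= szego_min rho n)%E.
  by apply: le_ereal_inf_tmp => _ [q _ <-]; exact: poweR_ge0.
have : (lne (szego_min rho n) <= (- y)%:E)%E.
  by rewrite -[leRHS]expeRK lee_lne ?in_itv/= ?leey ?andbT// lee_fin expR_ge0.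
case: (lne _) => [r| |]//=; last by rewrite leey.
rewrite !lee_fin lerNr => ry.
by rewrite (le_trans ry)// -normrN ler_norm.
Qed.

End extremal_problem.

(** * Chebyshev polynomials of an arc *)

Section chebyshev.
Variable R : realType.

(** The Chebyshev polynomials of the arc of the points [w * exp (i x)] of the unit
    circle with [|x| >= theta], for [|w| = 1] and [k = cos (theta / 2)]. At
    [z = w * exp (i x)] they take the value
    [2 k^n (w z)^(n/2) T_n (cos (x / 2) / k)], where [T_n] is the usual Chebyshev
    polynomial; the recurrence is that of [T_n], and the half-integral powers
    cancel out. The polynomial of index 0 is the constant 2, hence not monic. *)
Fixpoint arc_cheb (k w : R[i]) (n : nat) : {poly R[i]} :=
  match n with
  | 0 => 2%:P
  | n'.+1 => match n' with
    | 0 => 'X + w%:P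
    | m.+1 => ('X + w%:P) * arc_cheb k w n' - (k ^+ 2 * w) *: ('X * arc_cheb k w m)
    end
  end.

Lemma arc_chebSS k w n : arc_cheb k w n.+2 =
  ('X + w%:P) * arc_cheb k w n.+1 - (k ^+ 2 * w) *: ('X * arc_cheb k w n).
Proof. by []. Qed.

(** The analogue of [2 T_n (cos u) = exp (i n u) + exp (- i n u)]. *)
Lemma horner_arc_cheb k w n z a b : a + b = z + w -> a * b = k ^+ 2 * w * z ->
  (arc_cheb k w n).[z] = a ^+ n + b ^+ n.
Proof.
move=> sab pab.
suff [] : (arc_cheb k w n).[z] = a ^+ n + b ^+ n /\
    (arc_cheb k w n.+1).[z] = a ^+ n.+1 + b ^+ n.+1 by [].
elim: n => [|n [ih0 ih1]].
  by rewrite !expr0 !expr1 sab /= !hornerE.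
split=> //; rewrite arc_chebSS hornerD hornerN hornerZ !hornerM
  hornerD !hornerX hornerC ih0 ih1.
by rewrite -sab mulrA -pab !exprS; ring.
Qed.

Lemma size_arc_cheb k w n : (0 < n)%N ->
  size (arc_cheb k w n) = n.+1 /\ arc_cheb k w n \is monic.
Proof.
have h1 : size ('X + w%:P) = 2%N /\ 'X + w%:P \is monic.
  by rewrite -[w%:P]opprK -rmorphN/= size_XsubC monicXsubC.
suff : (0 < n)%N -> (size (arc_cheb k w n.-1) <= n)%N /\
  (size (arc_cheb k w n) = n.+1 /\ arc_cheb k w n \is monic) by move=> h /h[].
have [szX mX] := h1.
elim: n => // -[_ _|n ih _]; first by split => //=; rewrite size_polyC_leq1.
have [sn [sn1 mn1]] := ih isT; split; first by rewrite sn1.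
rewrite arc_chebSS.
have s1 : size (('X + w%:P) * arc_cheb k w n.+1) = n.+3.
  by rewrite size_Mmonic ?monic_neq0 // ?h1.2// -?size_poly_eq0 h1.1 sn1.
have s2 : (size (- ((k ^+ 2 * w) *: ('X * arc_cheb k w n)) : {poly R[i]}) < n.+3)%N.
  rewrite size_polyN (leq_ltn_trans (size_scale_leq _ _))//.
  by rewrite (leq_ltn_trans (size_polyMleq _ _))// size_polyX/= !ltnS.
split; first by rewrite size_polyDl s1.
by rewrite monicE lead_coefDl ?s1// -monicE monicMl.
Qed.

End chebyshev.

Section chebyshev_bounds.
Variable R : realType.
Implicit Types (m eta : R).

Lemma normc_sum_powers (a b : R[i]) (r : R) n :
  normc a ^+ 2 <= r ^+ 2 -> normc b ^+ 2 <= r ^+ 2 -> 0 <= r ->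
  normc (a ^+ n + b ^+ n) ^+ 2 <= 4 * (r ^+ 2) ^+ n.
Proof.
move=> ar br r0.
have {}ar : normc a <= r by rewrite -(@ler_pXn2r _ 2)// nnegrE normc_ge0.
have {}br : normc b <= r by rewrite -(@ler_pXn2r _ 2)// nnegrE normc_ge0.
have -> : 4 * (r ^+ 2) ^+ n = (2 * r ^+ n) ^+ 2.
  by rewrite [RHS]exprMn -!exprM mulnC; congr (_ * _); rewrite -natrX.
rewrite ler_pXn2r ?nnegrE ?normc_ge0 ?mulr_ge0 ?exprn_ge0//.
rewrite (le_trans (normcD _ _))// !normcX mulrDl !mul1r.
by rewrite lerD// lerXn2r// nnegrE normc_ge0.
Qed.

(** At a point at angular distance [2 pi (x - m)] from the centre, the two
    summands of the Chebyshev polynomial are [s (c + d)] and [s (c - d)] for a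
    unimodular [s], with [c = cos (pi (x - m))] and [d ^ 2 = c ^ 2 - k ^ 2]. *)
Lemma arc_cheb_expi (k m x : R) (d : R[i]) n :
  d ^+ 2 = ((cos (pi * (x - m)) ^+ 2 - k ^+ 2)%:C)%C ->
  (arc_cheb k%:C (circle_val (expi m)) n).[circle_val (expi x)] =
  (cis (pi * (x + m)) * ((cos (pi * (x - m)))%:C + d)) ^+ n +
  (cis (pi * (x + m)) * ((cos (pi * (x - m)))%:C - d)) ^+ n.
Proof.
move=> dE; set c := cos _ in dE *; set s := cis _.
have xE : circle_val (expi x) = s * cis (pi * (x - m)).
  by rewrite -cisD circle_valE; congr cis; ring.
have mE : circle_val (expi m) = s * cis (- (pi * (x - m))).
  by rewrite -cisD circle_valE; congr cis; ring.
apply: horner_arc_cheb.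
  rewrite xE mE -!mulrDr addrACA subrr addr0; congr (_ * _).
  by apply/eqP; rewrite eq_complex/= cosN sinN -/c subrr addr0 !eqxx.
have -> : s * (c%:C + d) * (s * (c%:C - d)) = s ^+ 2 * (c%:C ^+ 2 - d ^+ 2) by ring.
rewrite dE -rmorphXn -rmorphB/= opprB addrC subrK.
rewrite -rmorphXn -mulrA [RHS]mulrC; congr (_ * _).
by rewrite xE mE mulrACA -(cisD (- _)) addNr cis0 mulr1 expr2.
Qed.

Lemma sqr_normc_arc_cheb_le (k m x : R) n : 0 <= k ->
  cos (pi * (x - m)) ^+ 2 <= k ^+ 2 ->
  normc (arc_cheb k%:C (circle_val (expi m)) n).[circle_val (expi x)] ^+ 2 <=
    4 * (k ^+ 2) ^+ n.
Proof.
move=> k0; set c := cos _ => ck.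
rewrite (@arc_cheb_expi _ _ _ (0 +i* Num.sqrt (k ^+ 2 - c ^+ 2))); last first.
  rewrite expr2; simpc; rewrite -expr2 sqr_sqrtr ?subr_ge0// opprB -/c.
  by congr (_ +i* _); ring.
apply: normc_sum_powers => //; rewrite normcM normc_cis mul1r sqr_normcE/= -/c.
  by rewrite addr0 add0r sqr_sqrtr ?subr_ge0//; lra.
by rewrite oppr0 addr0 add0r sqrrN sqr_sqrtr ?subr_ge0//; lra.
Qed.

(** Monic polynomials that are small off an arc of length [2 eta]: each degree
    contributes a factor [cos (pi eta)] to the modulus there, and at most
    [1 + sin (pi eta)] on the arc. *)
Lemma exists_arc_poly m eta n : (0 < n)%N -> 0 <= eta <= 2^-1 ->
  exists p : {poly R[i]}, [/\ p \is monic, size p = n.+1,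
    forall t, normc p.[circle_val t] ^+ 2 <= 4 * ((1 + sin (pi * eta)) ^+ 2) ^+ n &
    forall t, ~ (@expi R @` `]m - eta, m + eta[) t ->
      normc p.[circle_val t] ^+ 2 <= 4 * (cos (pi * eta) ^+ 2) ^+ n].
Proof.
move=> n0 /andP[eta0 eta1].
have pi0 := pi_gt0 R.
have pe0 : 0 <= pi * eta by rewrite mulr_ge0// ltW.
have pe1 : pi * eta <= pi / 2 by rewrite ler_pM2l.
have s0 : 0 <= sin (pi * eta) by rewrite sin_ge0_pi// pe0/=; lra.
have c0 : 0 <= cos (pi * eta) by rewrite cos_ge0_pihalf//; apply/andP; split; lra.
have cs := cos2Dsin2 (pi * eta).
have c1 := cos_le1 (pi * eta).
set k := cos (pi * eta) in c0 c1 cs *; set sn := sin _ in s0 cs *.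
exists (arc_cheb k%:C (circle_val (expi m)) n).
have [sp pm] := size_arc_cheb k%:C (circle_val (expi m)) n0; split => //.
  move=> t; have [x ->] := expi_surj t.
  set c := cos (pi * (x - m)).
  have cc1 : c ^+ 2 <= 1.
    have := cos2Dsin2 (pi * (x - m)); rewrite -/c.
    by have := sqr_ge0 (sin (pi * (x - m))); lra.
  have [ck|kc] := leP (c ^+ 2) (k ^+ 2).
    apply: (le_trans (sqr_normc_arc_cheb_le n c0 ck)).
    by rewrite ler_pM2l// lerXn2r ?nnegrE ?sqr_ge0//; nra.
  have d0 : 0 <= c ^+ 2 - k ^+ 2 by rewrite subr_ge0 ltW.
  set d := Num.sqrt (c ^+ 2 - k ^+ 2).
  have d2 : d ^+ 2 = c ^+ 2 - k ^+ 2 by rewrite sqr_sqrtr.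
  have dge0 : 0 <= d by rewrite sqrtr_ge0.
  rewrite (@arc_cheb_expi _ _ _ d%:C); last by rewrite -rmorphXn/= d2.
  have dsn : d <= sn by rewrite -(@ler_pXn2r _ 2)// ?nnegrE// d2; lra.
  have /andP[cc2 cc3] : -1 <= c <= 1 by rewrite cos_geN1 cos_le1.
  apply: normc_sum_powers; rewrite ?addr_ge0//.
  - rewrite normcM normc_cis mul1r -[X in normc X](rmorphD (real_complex R)).
    by rewrite normc_real real_normK ?num_real// -/c; nra.
  - rewrite normcM normc_cis mul1r -[X in normc X](rmorphB (real_complex R)).
    by rewrite normc_real real_normK ?num_real// -/c; nra.
move=> t tI; have [x xE /andP[x1 x2]] := expi_surj_itv m t.
move: tI; rewrite xE => tI.
have xm : eta <= `|x - m|.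
  rewrite leNgt; apply/negP => xm; apply: tI; exists x => //=.
  by move: xm; rewrite in_itv/= ltr_norml => /andP[? ?]; apply/andP; split; lra.
set c := cos (pi * (x - m)).
have ck : c ^+ 2 <= k ^+ 2.
  have -> : c = cos (pi * `|x - m|).
    rewrite /c; have [h|h] := ler0P (x - m) => //.
    by rewrite mulrN cosN.
  have xm2 : `|x - m| <= 2^-1 by rewrite ler_norml; apply/andP; split; lra.
  have pxm : pi * `|x - m| <= pi / 2 by rewrite ler_pM2l.
  have pxm' : pi * eta <= pi * `|x - m| by rewrite ler_pM2l.
  have cx0 : 0 <= cos (pi * `|x - m|).
    by rewrite cos_ge0_pihalf//; apply/andP; split; lra.
  rewrite ler_pXn2r ?nnegrE//.
  rewrite leNgt ltr_cos -?leNgt// in_itv/=; apply/andP; split; lra.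
exact: sqr_normc_arc_cheb_le.
Qed.

End chebyshev_bounds.

(** * Fejer sums and polynomials of prescribed modulus *)

Section fejer.
Variable R : realType.
Implicit Types (u z : R[i]) (m N : nat).

(** The analytic Dirichlet kernel; on the unit circle its squared modulus is [m + 1]
    times the Fejer kernel. *)
Definition dirichlet m u : R[i] := \sum_(a < m.+1) u ^+ a.

(** Up to the factor [m + 1], the analytic part without constant term of the
    Fejer kernel, that is the sum of [(m + 1 - k) u^k] over [1 <= k <= m]. *)
Definition fejer_half m u : R[i] := \sum_(a < m.+1) \sum_(k < a) u ^+ k.+1.

(** The Fejer kernel [1 + 2 Re (fejer_half m u) / (m + 1)] is nonnegative. *)
Lemma sqr_dirichlet m u : normc u = 1 ->
  normc (dirichlet m u) ^+ 2 = m.+1%:R + 2 * complex.Re (fejer_half m u).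
Proof.
move=> u1; elim: m => [|m ih].
  rewrite /dirichlet /fejer_half !big_ord_recl !big_ord0 !addr0 expr0.
  by rewrite normc1 expr1n mulr0 addr0.
have dS : dirichlet m.+1 u = 1 + u * dirichlet m u.
  rewrite /dirichlet big_ord_recl expr0 mulr_sumr; congr (_ + _).
  by apply: eq_bigr => i _; rewrite -exprS.
have fS : fejer_half m.+1 u = fejer_half m u + u * dirichlet m u.
  rewrite /fejer_half big_ord_recr/=; congr (_ + _).
  by rewrite mulr_sumr; apply: eq_bigr => i _; rewrite -exprS.
rewrite dS fS sqr_normc_1D normcM u1 mul1r ih -[m.+2%:R]natr1.
by rewrite raddfD/=; ring.
Qed.

Lemma sqr_dirichlet_le m u : normc u = 1 ->
  normc (u - 1) ^+ 2 * normc (dirichlet m u) ^+ 2 <= 4.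
Proof.
move=> u1; rewrite -exprMn -normcM -subrX1 (_ : 4 = 2 ^+ 2); last by rewrite -natrX.
rewrite ler_pXn2r ?nnegrE ?normc_ge0//.
by rewrite (le_trans (normcD _ _))// normc_opp normcX u1 expr1n normc1.
Qed.

Lemma sum_unity_roots N d : (0 < d < N)%N ->
  \sum_(j < N) circle_val (expi (j%:R / N%:R : R)) ^+ d = 0.
Proof.
move=> /andP[d0 dN].
have N0 : N%:R != 0 :> R by rewrite pnatr_eq0 -lt0n (ltn_trans d0).
set q := circle_val (expi (d%:R / N%:R : R)).
have qE (j : nat) : circle_val (expi (j%:R / N%:R : R)) ^+ d = q ^+ j.
  by rewrite /q !circle_valE -!cis_nat; congr cis; ring.
under eq_bigr do rewrite qE.
have qN : q ^+ N = 1.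
  by rewrite /q circle_valE -cis_nat mulrA divfK// cis_nat cis_2pi expr1n.
have q1 : q - 1 != 0.
  rewrite subr_eq0; apply/eqP => h.
  have /eqP : d%:R / N%:R = 0 :> R.
    apply: expi_inj_lt1.
      rewrite subr0 ger0_norm// ltr_pdivrMr ?ltr0n ?(ltn_trans d0)//.
      by rewrite mul1r ltr_nat.
    by apply: circle_val_inj; rewrite -/q h circle_valE mulr0 cis0.
  by rewrite mulf_eq0 invr_eq0 (negbTE N0) orbF pnatr_eq0 gtn_eqF.
by apply: (mulfI q1); rewrite -subrX1 qN subrr mulr0.
Qed.

Lemma sum_fejer_half m N z : (m < N)%N ->
  \sum_(j < N) fejer_half m (circle_val (expi (j%:R / N%:R : R)) * z) = 0.
Proof.
move=> mN; rewrite exchange_big big1// => a _.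
rewrite exchange_big big1// => k _.
under eq_bigr do rewrite exprMn.
rewrite -mulr_suml sum_unity_roots ?mul0r//=.
by rewrite (leq_trans _ mN)// ltnS (leq_trans (ltn_ord k))// -ltnS.
Qed.

Lemma normc_fejer_half m u : normc u = 1 ->
  normc (fejer_half m u) <= m.+1%:R * m.+1%:R.
Proof.
move=> u1; apply: (le_trans (normc_sum _ _)).
have -> : m.+1%:R * m.+1%:R = \sum_(a < m.+1) m.+1%:R :> R.
  by rewrite sumr_const card_ord mulr_natl.
apply: ler_sum => a _.
apply: (le_trans (normc_sum _ _)).
under eq_bigr do rewrite normcX u1 expr1n.
by rewrite sumr_const card_ord ler_nat ltnW.
Qed.

End fejer.

Section outer_polynomial.
Variable R : realType.
Implicit Types (g : circle R -> R) (t : circle R).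

(* The [N]-th roots of unity, at which functions are sampled. *)
Let uroot N j : circle R := expi (j%:R / N%:R).

(** For [m < N], the polynomial in [1 / t] without constant term such that twice its
    real part is the difference between the Fejer sum of degree [m] of [g], sampled
    at the [N]-th roots of unity, and the mean of the samples. *)
Definition fejer_analytic g m N t : R[i] :=
  ((N%:R * m.+1%:R)^-1)%:C * \sum_(j < N) (g (uroot N j))%:C *
    fejer_half m (circle_val (uroot N j) * ((circle_val t)^*)%C).

(** The Fejer sum of [g] exceeds [g] by at most 1 once the degree [m] is large
    compared with the square of the Lipschitz constant. *)
Lemma Re_fejer_analytic_le g (r : R) m N t : 0 <= r ->
  (forall s t, g t - g s <= r * normc (circle_val s - circle_val t)) ->
  4 * r ^+ 2 <= m.+1%:R -> (m < N)%N ->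
  2 * complex.Re (fejer_analytic g m N t) <=
    g t + 1 - (\sum_(j < N) g (uroot N j)) / N%:R.
Proof.
move=> r0 gr rm mN.
have N0 : 0 < N%:R :> R by rewrite ltr0n (leq_trans _ mN).
have M0 : 0 < m.+1%:R :> R by rewrite ltr0n.
pose u (j : 'I_N) : R[i] := circle_val (uroot N j) * ((circle_val t)^*)%C.
have u1 j : normc (u j) = 1 by rewrite normcM normc_conj !normc_circle mulr1.
pose S j := normc (dirichlet m (u j)) ^+ 2.
have sumS : \sum_(j < N) S j = N%:R * m.+1%:R.
  rewrite /S; under eq_bigr do rewrite sqr_dirichlet//.
  rewrite big_split/= sumr_const card_ord -mulr_sumr -raddf_sum/=.
  by rewrite sum_fejer_half//= mulr0 addr0 [RHS]mulr_natl.
have distE (j : 'I_N) : normc (circle_val t - circle_val (uroot N j)) = normc (u j - 1).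
  have -> : u j - 1 = (circle_val (uroot N j) - circle_val t) * ((circle_val t)^*)%C.
    by rewrite mulrBl mul_conjc normc_circle expr1n.
  by rewrite normcM normc_conj normc_circle mulr1 -normc_opp opprB.
have le_j (j : 'I_N) : g (uroot N j) * S j <= (g t + 2^-1) * S j + 2 * r ^+ 2.
  have h1 := gr t (uroot N j); rewrite distE in h1.
  have h2 := sqr_dirichlet_le m (u1 j).
  have S0 : 0 <= S j by exact: sqr_ge0.
  rewrite -/(S j) in h2; move: (S j) S0 h2 h1 => s s0.
  set d := normc _ => h2 h1.
  (* [rd <= (1 + r^2 d^2) / 2] brings in the second moment of the kernel, which
     [sqr_dirichlet_le] controls without any summation. *)
  have h3 : r * d <= 2^-1 + r ^+ 2 * d ^+ 2 / 2.
    by have := sqr_ge0 (r * d - 1); rewrite -exprMn; lra.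
  have h4 : g (uroot N j) * s <= (g t + 2^-1 + r ^+ 2 * d ^+ 2 / 2) * s.
    by apply: ler_wpM2r => //; lra.
  apply: (le_trans h4); rewrite mulrDl lerD2l.
  have : r ^+ 2 * (d ^+ 2 * s) <= r ^+ 2 * 4 by rewrite ler_wpM2l// sqr_ge0.
  lra.
have sum_le : \sum_(j < N) g (uroot N j) * S j <= (g t + 1) * (N%:R * m.+1%:R).
  apply: (le_trans (ler_sum _ (fun j _ => le_j j))).
  rewrite big_split/= -mulr_sumr sumS sumr_const card_ord -mulr_natl.
  have : N%:R * (4 * r ^+ 2) <= N%:R * m.+1%:R by rewrite ler_wpM2l// ltW.
  lra.
have sumE : \sum_(j < N) g (uroot N j) * S j = m.+1%:R * \sum_(j < N) g (uroot N j) +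
    2 * complex.Re (\sum_(j < N) (g (uroot N j))%:C * fejer_half m (u j)).
  rewrite raddf_sum/= !mulr_sumr -big_split/=; apply: eq_bigr => j _.
  rewrite /S sqr_dirichlet//; case: (fejer_half _ _) => a b /=; ring.
have reE : 2 * complex.Re (fejer_analytic g m N t) = (N%:R * m.+1%:R)^-1 *
    (2 * complex.Re (\sum_(j < N) (g (uroot N j))%:C * fejer_half m (u j))).
  rewrite /fejer_analytic; case: (\sum_(j < N) _) => a b /=; ring.
rewrite reE mulrC ler_pdivrMr ?mulr_gt0// mulrBl.
have -> : (\sum_(j < N) g (uroot N j)) / N%:R * (N%:R * m.+1%:R) =
    m.+1%:R * \sum_(j < N) g (uroot N j).
  by rewrite mulrA divfK ?gt_eqF// mulrC.
by rewrite lerBrDl -sumE.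
Qed.

Lemma fejer_analytic_bounded g m N : exists B, forall t,
  normc (fejer_analytic g m N t) <= B.
Proof.
exists (`|(N%:R * m.+1%:R)^-1| *
  \sum_(j < N) `|g (uroot N j)| * (m.+1%:R * m.+1%:R)) => t.
rewrite normcM normc_real ler_wpM2l//.
apply: (le_trans (normc_sum _ _)); apply: ler_sum => j _.
rewrite normcM normc_real ler_wpM2l// normc_fejer_half//.
by rewrite normcM normc_conj !normc_circle mulr1.
Qed.

(** [1 + c * fejer_analytic g m N] is a polynomial in [1 / t] of degree at most [m]
    with constant term 1, so its product with [t ^ m] is monic. *)
Lemma exists_fejer_poly g m N (c : R) : exists p : {poly R[i]},
  p \is monic /\ forall t,
    normc p.[circle_val t] = normc (1 + c%:C * fejer_analytic g m N t).
Proof.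
pose q : {poly R[i]} := c%:C *: (((N%:R * m.+1%:R)^-1)%:C *:
  \sum_(j < N) (g (uroot N j))%:C *: \sum_(a < m.+1) \sum_(k < a)
    circle_val (uroot N j) ^+ k.+1 *: 'X^(m - k.+1)).
have sq : (size q < size ('X^m : {poly R[i]}))%N.
  rewrite size_polyXn ltnS /q.
  do 2 apply: (leq_trans (size_scale_leq _ _)).
  apply: (leq_trans (size_sum _ _ _)); apply/bigmax_leqP => j _.
  apply: (leq_trans (size_scale_leq _ _)).
  apply: (leq_trans (size_sum _ _ _)); apply/bigmax_leqP => a _.
  apply: (leq_trans (size_sum _ _ _)); apply/bigmax_leqP => k _.
  apply: (leq_trans (size_scale_leq _ _)); rewrite size_polyXn.
  have km : (k < m)%N by rewrite (leq_trans (ltn_ord k))// -ltnS.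
  by rewrite subnSK// leq_subr.
exists ('X^m + q); split; first by rewrite monicE lead_coefDl// lead_coefXn.
move=> t; set z := circle_val t.
have zz : z * (z^*)%C = 1 by rewrite mul_conjc normc_circle expr1n.
have -> : ('X^m + q).[z] = z ^+ m * (1 + c%:C * fejer_analytic g m N t).
  rewrite hornerD hornerXn mulrDr mulr1; congr (_ + _).
  rewrite /q /fejer_analytic !hornerZ horner_sum [RHS]mulrCA; congr (_ * _).
  rewrite [RHS]mulrCA; congr (_ * _); rewrite mulr_sumr; apply: eq_bigr => j _.
  rewrite hornerZ [RHS]mulrCA; congr (_ * _).
  rewrite /fejer_half horner_sum mulr_sumr; apply: eq_bigr => a _.
  rewrite horner_sum mulr_sumr; apply: eq_bigr => k _.
  have km : (k.+1 <= m)%N by rewrite (leq_trans (ltn_ord k))// -ltnS.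
  rewrite hornerZ hornerXn exprMn [RHS]mulrCA; congr (_ * _).
  have -> : z ^+ m = z ^+ (m - k.+1) * z ^+ k.+1 by rewrite -exprD subnK.
  by rewrite -mulrA -exprMn zz expr1n mulr1.
by rewrite normcM normcX normc_circle expr1n mul1r.
Qed.

(** The polynomial is [(t^m (1 + h / L))^L] where [2 Re h] is the Fejer sum of
    [g] minus its mean. On the circle
    [|1 + h / L|^(2 L) <= exp (2 Re h + |h|^2 / L)], and [L] is chosen larger than
    [|h|^2]. *)
Lemma exists_monic_le_exp g (r : R) : 0 <= r ->
  (forall s t, g t - g s <= r * normc (circle_val s - circle_val t)) ->
  exists N0, forall N, (N0 <= N)%N -> exists p : {poly R[i]}, p \is monic /\
    forall t, normc p.[circle_val t] ^+ 2 <=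
      expR (g t + 2 - (\sum_(j < N) g (uroot N j)) / N%:R).
Proof.
move=> r0 gr.
pose m := Num.truncn (4 * r ^+ 2).
exists m.+1 => N mN.
have rm : 4 * r ^+ 2 <= m.+1%:R by apply/ltW/truncnS_gt.
have [B hB] := fejer_analytic_bounded g m N.
pose L := (Num.truncn (B ^+ 2)).+1.
have L0 : 0 < L%:R :> R by rewrite ltr0n.
have BL : B ^+ 2 <= L%:R by apply/ltW/truncnS_gt.
have [p [pm pE]] := exists_fejer_poly g m N (L%:R^-1).
exists (p ^+ L); split; first exact: monic_exp.
move=> t; rewrite horner_exp normcX -exprM mulnC exprM pE.
set h := fejer_analytic g m N t.
have hre := Re_fejer_analytic_le t r0 gr rm mN; rewrite -/h in hre.
have hb : normc h ^+ 2 <= B ^+ 2.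
  by rewrite ler_pXn2r ?nnegrE ?normc_ge0 ?hB// (le_trans _ (hB t))// normc_ge0.
set e := 2 * complex.Re h / L%:R + normc h ^+ 2 / L%:R ^+ 2.
have eE : normc (1 + (L%:R^-1)%:C * h) ^+ 2 = 1 + e.
  rewrite sqr_normc_1D normcM normc_real exprMn real_normK ?num_real// /e exprVn.
  by case: (h) => a b /=; ring.
have e1 : 0 <= 1 + e by rewrite -eE sqr_ge0.
rewrite eE.
apply: (@le_trans _ _ (expR e ^+ L)).
  by rewrite lerXn2r ?nnegrE ?expR_ge0// expR_ge1Dx.
rewrite -expRM_natl ler_expR /e mulrDr.
have -> : L%:R * (2 * complex.Re h / L%:R) = 2 * complex.Re h.
  by rewrite mulrC divfK// gt_eqF.
have : L%:R * (normc h ^+ 2 / L%:R ^+ 2) <= 1.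
  have -> : L%:R * (normc h ^+ 2 / L%:R ^+ 2) = normc h ^+ 2 / L%:R.
    by field; rewrite gt_eqF.
  by rewrite ler_pdivrMr// mul1r; exact: le_trans BL.
lra.
Qed.

End outer_polynomial.

(** * Lipschitz minorants and Riemann sums *)

Section lipschitz_minorant.
Variables (R : realType) (H : circle R -> \bar R).
Hypothesis H0 : forall t, (0 <= H t)%E.

(** The truncation of [H] at height [n]. *)
Definition truncation n (t : circle R) : R := fine (Order.min (H t) n%:R%:E).

(** The largest [n]-Lipschitz function, for the chord distance, below the truncation
    of [H] at height [n]. *)
Definition lipschitz_env n (t : circle R) : R :=
  inf (range (fun s => truncation n s + n%:R * normc (circle_val s - circle_val t))).

Lemma truncationE n t : ((truncation n t)%:E = Order.min (H t) n%:R%:E)%E.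
Proof.
rewrite /truncation; have := H0 t; case: (H t) => [h| |]//= _.
by rewrite -EFin_min.
Qed.

Lemma truncation_ge0 n t : 0 <= truncation n t.
Proof. by rewrite -lee_fin truncationE le_min H0/= lee_fin. Qed.

Lemma lipschitz_env_lb n t :
  lbound (range (fun s => truncation n s + n%:R * normc (circle_val s - circle_val t))) 0.
Proof.
by move=> _ [s _ <-]; rewrite addr_ge0// ?truncation_ge0// mulr_ge0// normc_ge0.
Qed.

Lemma lipschitz_env_le n t s :
  lipschitz_env n t <= truncation n s + n%:R * normc (circle_val s - circle_val t).
Proof.
apply: ge_inf; last by exists s.
by exists 0; exact: lipschitz_env_lb.
Qed.

Lemma lipschitz_env_ge n t a :
  (forall s, a <= truncation n s + n%:R * normc (circle_val s - circle_val t)) ->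
  a <= lipschitz_env n t.
Proof.
move=> h; apply: lb_le_inf; last by move=> _ [s _ <-].
by exists (truncation n t + n%:R * normc (circle_val t - circle_val t)); exists t.
Qed.

Lemma lipschitz_env_ge0 n t : 0 <= lipschitz_env n t.
Proof.
by apply: lipschitz_env_ge => s; apply: (@lipschitz_env_lb n t); exists s.
Qed.

Lemma lipschitz_env_le_fun n t : ((lipschitz_env n t)%:E <= H t)%E.
Proof.
apply: (@le_trans _ _ (truncation n t)%:E).
  by have := lipschitz_env_le n t t; rewrite subrr normc0 mulr0 addr0 lee_fin.
by rewrite truncationE ge_min lexx.
Qed.

Lemma lipschitz_env_lipschitz n s t :
  lipschitz_env n t - lipschitz_env n s <= n%:R * normc (circle_val s - circle_val t).
Proof.
rewrite lerBlDr -lerBlDl; apply: lipschitz_env_ge => v.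
rewrite lerBlDr (le_trans (lipschitz_env_le n t v))// -addrA lerD2l.
rewrite -mulrDr ler_wpM2l// (le_trans _ (normcD _ _))//.
by rewrite addrA subrK.
Qed.

Lemma lipschitz_env_homo t :
  {homo (fun n => (lipschitz_env n t)%:E) : n m / (n <= m)%N >-> (n <= m)%E}.
Proof.
move=> n m nm; rewrite lee_fin; apply: lipschitz_env_ge => s.
apply: (le_trans (lipschitz_env_le n t s)); apply: lerD; last first.
  by rewrite ler_wpM2r ?normc_ge0// ler_nat.
by rewrite -lee_fin !truncationE le_min !ge_min lexx/= lee_fin ler_nat nm orbT.
Qed.

Hypothesis Hlsc : lower_semicontinuous H.

Lemma measurable_lipschitz_env n :
  measurable_fun setT (fun t => (lipschitz_env n t)%:E).
Proof.
apply/measurable_EFinP; apply: (@lipschitz_measurable _ n.+1%:R) => // s t.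
apply: (le_trans (lipschitz_env_lipschitz n s t)).
by rewrite ler_wpM2r ?normc_ge0// ler_nat.
Qed.

(** Lower semicontinuity makes the Lipschitz minorants increase to [H]. *)
Lemma le_lim_lipschitz_env t : (H t <= limn (fun n => (lipschitz_env n t)%:E))%E.
Proof.
have cvl := ereal_nondecreasing_is_cvgn (lipschitz_env_homo t).
have lim_ge a : (a%:E < H t)%E -> (a%:E <= limn (fun n => (lipschitz_env n t)%:E))%E.
  move=> aH; have [V /nbhs_circleP[e e0 eV] VH] := Hlsc aH.
  apply: lime_ge => //.
  pose n0 := (Num.truncn (Num.max a (a / e))).+1.
  exists n0 => // n /= nn0; rewrite lee_fin; apply: lipschitz_env_ge => s.
  have : Num.max a (a / e) < n%:R.
    by apply: (lt_le_trans (truncnS_gt _)); rewrite ler_nat.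
  rewrite gt_max ltr_pdivrMr// => /andP[an aen].
  have [se|es] := ltP (normc (circle_val s - circle_val t)) e.
    rewrite ler_wpDr ?mulr_ge0 ?normc_ge0//.
    by rewrite -lee_fin truncationE le_min lee_fin !ltW// VH//; exact: eV.
  rewrite ler_wpDl ?truncation_ge0//.
  by rewrite (le_trans (ltW aen))// ler_wpM2l.
have lim0 : (0 <= limn (fun n => (lipschitz_env n t)%:E))%E.
  by apply: lime_ge => //; exists 0%N => // n _; rewrite lee_fin lipschitz_env_ge0.
rewrite leNgt; apply/negP => lt.
move: (limn _) lim0 lim_ge lt => [l| |]// _ h; last by rewrite ltNge leey.
case: (H t) h => [b| |]//= h.
  rewrite lte_fin => lb; have := h ((l + b) / 2).
  by rewrite lte_fin lee_fin => /(_ ltac:(lra)); lra.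
by move=> _; have := h _ (ltry (l + 1)); rewrite lee_fin; lra.
Qed.

Lemma exists_lipschitz_env (M : R) : (\int[@circle_leb R]_t H t = +oo)%E ->
  exists n, (M%:E < \int[@circle_leb R]_t (lipschitz_env n t)%:E)%E.
Proof.
move=> Hoo; apply: contrapT => /forallNP hM.
have : (\int[@circle_leb R]_t H t <= M%:E)%E.
  apply: (@le_trans _ _
      (\int[@circle_leb R]_t limn (fun n => (lipschitz_env n t)%:E))%E).
    apply: ge0_le_integral => //.
    - exact: lsc_measurable.
    - apply: (@emeasurable_fun_cvg _ _ _ _ (fun n t => (lipschitz_env n t)%:E)).
        by move=> n; exact: measurable_lipschitz_env.
      move=> t _; exact: (ereal_nondecreasing_is_cvgn (lipschitz_env_homo t)).
    - by move=> t _; exact: le_lim_lipschitz_env.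
  rewrite (@monotone_convergence _ _ _ (@circle_leb R) setT measurableT
    (fun n t => (lipschitz_env n t)%:E)).
  - apply: lime_le.
      apply: ereal_nondecreasing_is_cvgn => n m nm; apply: ge0_le_integral => //.
      + by move=> t _; rewrite lee_fin lipschitz_env_ge0.
      + exact: measurable_lipschitz_env.
      + exact: measurable_lipschitz_env.
      + by move=> t _; exact: lipschitz_env_homo.
    by exists 0%N => // n _ /=; rewrite leNgt; apply/negP; exact: hM.
  - by move=> n; exact: measurable_lipschitz_env.
  - by move=> n t _; rewrite lee_fin lipschitz_env_ge0.
  - by move=> t _; exact: lipschitz_env_homo.
by rewrite Hoo leye_eq.
Qed.

End lipschitz_minorant.

Section riemann_sum.
Variable R : realType.

(** The error term is the Lipschitz constant times the bound [16 / N] for the chord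
    of an arc of length [1 / N]. *)
Lemma integral_circle_le_riemann_sum (g : circle R -> R) (r : R) N :
  (0 < N)%N -> 0 < r -> (forall t, 0 <= g t) ->
  (forall s t, g t - g s <= r * normc (circle_val s - circle_val t)) ->
  (\int[@circle_leb R]_t (g t)%:E <=
   ((\sum_(j < N) g (expi (j%:R / N%:R))) / N%:R + 16 * r / N%:R)%:E)%E.
Proof.
move=> N0 r0 g0 gr.
have NR0 : 0 < N%:R :> R by rewrite ltr0n.
have mg : measurable_fun setT (fun t => (g t)%:E).
  by apply/measurable_EFinP; exact: lipschitz_measurable gr.
rewrite /circle_leb ge0_integral_pushforward//; last 2 first.
- exact: measurable_expi.
- by move=> t _; rewrite lee_fin.
rewrite preimage_setT.
pose mu : {measure set (measurableTypeR R) -> \bar R} :=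
  mrestr (@lebesgue_measure R) (measurable_itv `[0%R, 1%R[).
change (\int[mu]_x (g (expi x))%:E <=
  ((\sum_(j < N) g (expi (j%:R / N%:R))) / N%:R + 16 * r / N%:R)%:E)%E.
pose I (j : 'I_N) : set R := `[j%:R / N%:R, j.+1%:R / N%:R[%classic.
pose c (j : 'I_N) := g (expi (j%:R / N%:R)) + 16 * r / N%:R.
have c0 j : 0 <= c j.
  by rewrite addr_ge0// divr_ge0 ?mulr_ge0 ?ler0n// ltW.
have mI j : measurable (I j) by exact: measurable_itv.
have muI j : (mu (I j) <= (N%:R^-1)%:E)%E.
  rewrite /mu/= /mrestr; apply: (@le_trans _ _ (lebesgue_measure (I j))).
    apply: le_measure; last exact: subIsetl.
      by rewrite inE; apply: measurableI; exact: measurable_itv.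
    by rewrite inE; exact: mI.
  rewrite lebesgue_measure_itv/= lte_fin ltr_pM2r ?invr_gt0// ltr_nat ltnSn.
  by rewrite -EFinD lee_fin -mulrBl -natr1 addrAC subrr add0r mul1r.
have mcI j : measurable_fun setT (fun x => (c j * \1_(I j) x)%:E).
  by apply/measurable_EFinP; exact: measurable_funM.
(* [mu] does not charge the complement of [0, 1[, where the step function
   vanishes. *)
apply: (@le_trans _ _ (\int[mu]_x \sum_(j < N) (c j * \1_(I j) x)%:E)%E).
  apply: ae_ge0_le_integral => //.
  - by move=> x _ /=; rewrite lee_fin.
  - exact: (measurableT_comp mg (@measurable_expi R)).
  - by move=> x _; apply: sume_ge0 => j _; rewrite lee_fin mulr_ge0.
  - exact: emeasurable_sum.
  exists (~` `[0, 1[%classic); split.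
  - by apply: measurableC; exact: measurable_itv.
  - by rewrite /mu/= /mrestr setICl measure0.
  apply: subsetC => x /=; rewrite in_itv/= => /andP[x0 x1] _.
  pose k := Num.truncn (x * N%:R).
  have xN0 : 0 <= x * N%:R by rewrite mulr_ge0// ltW.
  have /andP[k1 k2] := truncn_itv xN0; rewrite -/k in k1 k2.
  have kN : (k < N)%N.
    rewrite -(ltr_nat R) (le_lt_trans k1)// -[ltRHS]mul1r.
    by rewrite ltr_pM2r.
  rewrite sumEFin lee_fin (bigD1 (Ordinal kN))//= ler_wpDr//.
    by apply: sumr_ge0 => j _; rewrite mulr_ge0.
  have -> : \1_(I (Ordinal kN)) x = 1 :> R.
    rewrite indicE mem_set//= /I/= in_itv/=.
    by rewrite ler_pdivrMr// k1 ltr_pdivlMr.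
  rewrite mulr1 /c/= -lerBlDl (le_trans (gr _ _))//.
  rewrite -mulrA mulrCA ler_pM2l// (le_trans (expi_chord_le _ _))//.
  have xlo : k%:R / N%:R <= x by rewrite ler_pdivrMr.
  have xhi : x <= k%:R / N%:R + N%:R^-1.
    by rewrite -{2}[N%:R^-1]mul1r -mulrDl natr1 ler_pdivlMr// ltW.
  have Ni0 : 0 < N%:R^-1 :> R by rewrite invr_gt0.
  by rewrite ler_wpM2l// ler_norml; apply/andP; split; lra.
rewrite ge0_integral_sum//; last first.
  by move=> j x _; rewrite lee_fin mulr_ge0.
apply: (@le_trans _ _ (\sum_(j < N) (c j * N%:R^-1)%:E)%E).
  apply: lee_sum => j _.
  under eq_integral do rewrite EFinM.
  rewrite ge0_integralZl_EFin//; last first.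
    by apply/measurable_EFinP; apply: measurable_indic; exact: mI.
  rewrite integral_indic; [|exact: measurableT|exact: mI].
  by rewrite setIT EFinM lee_wpmul2l ?lee_fin.
rewrite sumEFin lee_fin -mulr_suml big_split/= mulrDl lerD2l sumr_const card_ord.
rewrite -[_ *+ N]mulr_natl ler_pdivrMr//.
by rewrite mulrC.
Qed.

End riemann_sum.

(** * Arcs and lower bounds for the logarithm *)

Section arcs.
Variable R : realType.
Implicit Types (a b x y : R).

Lemma expi_eq x y : expi x = expi y -> exists k : int, x = y + k%:~R.
Proof.
move=> xy; exists (Num.floor (x - y)).
apply: expi_inj_lt1; last by rewrite expi_int.
have /andP[k1 k2] := floor_itv (x - y).
by move: k2; rewrite intrD => k2; rewrite ltr_norml; apply/andP; split; lra.
Qed.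

Lemma measurable_preimage_arc a b :
  measurable (@expi R @^-1` (@expi R @` `]a, b[) : set (measurableTypeR R)).
Proof.
apply: open_measurable.
have -> : @expi R @^-1` (@expi R @` `]a, b[) =
    \bigcup_(k in [set: int]) `]a + k%:~R, b + k%:~R[%classic.
  apply/seteqP; split=> x /=.
    move=> [y]; rewrite /= in_itv/= => /andP[ay yb] /esym /expi_eq[k ->].
    by exists k => //=; rewrite in_itv/= !ltrD2r ay.
  move=> [k _] /=; rewrite in_itv/= => /andP[ax xb].
  exists (x - k%:~R); first by rewrite /= in_itv/= ltrBrDr ltrBlDr ax.
  by rewrite -[RHS](expi_int _ (- k)) rmorphN.
by apply: bigcup_open => k _; exact: interval_open.
Qed.

Lemma circle_leb_arc_le1 a b : (circle_leb (@expi R @` `]a, b[) <= 1)%E.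
Proof.
rewrite /circle_leb /pushforward /mrestr.
apply: (@le_trans _ _ (@lebesgue_measure R `[0, 1[)).
  apply: le_measure; last exact: subIsetr.
    by rewrite inE; apply: measurableI => //; exact: measurable_preimage_arc.
  by rewrite inE; exact: measurable_itv.
by rewrite lebesgue_measure_itv/= lte_fin ltr01 oppr0 adde0.
Qed.

(** The constant 2 is not optimal; it avoids splitting an arc whose parametrization
    crosses an integer into disjoint pieces. *)
Lemma circle_leb_arc_le a b : a <= b ->
  (circle_leb (@expi R @` `]a, b[) <= (2 * (b - a))%:E)%E.
Proof.
move=> ab; have [h|h] := leP 2^-1 (b - a).
  by rewrite (le_trans (circle_leb_arc_le1 a b))// lee_fin; lra.
pose n := Num.floor a; pose a0 := a - n%:~R; pose b0 := b - n%:~R.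
have /andP[n1 n2] := floor_itv a; rewrite -/n intrD in n1 n2.
rewrite /circle_leb /pushforward /mrestr.
apply: (@le_trans _ _ (@lebesgue_measure R (`]a0, b0[ `|` `]a0 - 1, b0 - 1[))).
  apply: le_measure.
  - rewrite inE; apply: measurableI; first exact: measurable_preimage_arc.
    exact: measurable_itv.
  - by rewrite inE; apply: measurableU; exact: measurable_itv.
  move=> x [[y /= + /esym /expi_eq[k xE]]].
  rewrite !in_itv/= => /andP[ay yb] /andP[x0 x1].
  pose l := k + n.
  have {}xE : x = (y - n%:~R) + l%:~R by rewrite xE /l intrD; lra.
  have l1 : l < 1 by rewrite -(@ltr_int R); lra.
  have l2 : -2 < l by rewrite -(@ltr_int R) rmorphN/=; lra.
  have [l0|lN1] : l = 0 \/ l = -1 by lia.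
    by left; rewrite /= ?in_itv/= xE l0 addr0 /a0 /b0 !ltrD2r ay.
  right; rewrite /= ?in_itv/= xE lN1 /a0 /b0 rmorphN/=.
  by apply/andP; split; lra.
have itvE c d : c <= d -> (@lebesgue_measure R `]c, d[ = (d - c)%:E)%E.
  rewrite lebesgue_measure_itv/= lte_fin le_eqVlt => /predU1P[->|->//].
  by rewrite ltxx subrr.
apply: (le_trans (measureU2 _ _ _)); try exact: measurable_itv.
have e1 : (@lebesgue_measure R `]a0, b0[ = (b0 - a0)%:E)%E by rewrite itvE// lerD2r.
have e2 : (@lebesgue_measure R `](a0 - 1)%R, (b0 - 1)%R[ = (b0 - 1 - (a0 - 1))%:E)%E.
  by rewrite itvE// !lerD2r.
have -> : 2 * (b - a) = (b0 - a0) + (b0 - 1 - (a0 - 1)) by rewrite /a0 /b0; ring.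
rewrite EFinD; apply: leeD; [rewrite -e1|rewrite -e2]; exact: lexx.
Qed.

(** The supremum defining [longest_arc] need not be attained, and the length
    of an arc is only compared with that of its parametrization up to a factor 2;
    hence the factor 4. *)
Lemma longest_arc_witness (H : circle R -> \bar R) (A : R) :
  0 < longest_arc H A ->
  longest_arc H A <= 1 /\
  exists a b, longest_arc H A < 4 * (b - a) /\
    forall x, a < x < b -> (A%:E < H (expi x))%E.
Proof.
rewrite /longest_arc; set S := (X in ereal_sup X).
have S1 : (ereal_sup S <= 1)%E.
  apply: ge_ereal_sup => _ [_ [[a [b ->]] _] <-]; exact: circle_leb_arc_le1.
move=> L0.
have SE : ((fine (ereal_sup S))%:E = ereal_sup S)%E.
  by move: L0; case: (ereal_sup S) => [r| |]//=; rewrite ltxx.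
move: L0 SE; set L := fine _ => L0 SE; split; first by rewrite -lee_fin SE.
have /ereal_sup_gt[_ [_ [[a [b ->]] HI] <-] hL] : ((L / 2)%:E < ereal_sup S)%E.
  by rewrite -SE lte_fin; lra.
exists a, b; split; last by move=> x xab; apply: HI; exists x => //=; rewrite in_itv.
have [ab|ba] := leP a b.
  by have := lt_le_trans hL (circle_leb_arc_le ab); rewrite lte_fin; lra.
move: hL; rewrite [X in circle_leb X](_ : _ = set0); last first.
  by rewrite -subset0 => t [x /=]; rewrite in_itv/= => /andP[ax xb] _;
    have := lt_trans ax xb; rewrite ltNge (ltW ba).
by rewrite measure0 lte_fin; lra.
Qed.

End arcs.

Section lower_bounds.
Variables (R : realType) (H : circle R -> \bar R).
Variable rho : {finite_measure set (circle R) -> \bar R}.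
Hypothesis H0 : forall t, (0 <= H t)%E.
Hypothesis Hlsc : lower_semicontinuous H.
Hypothesis rho_H : (\int[rho]_t expeR (H t) < +oo)%E.

Let T := fine (rho setT).
Let K := fine (\int[rho]_t expeR (H t)).

Let rhoTE : (rho setT = T%:E)%E.
Proof. by rewrite fineK// fin_num_measure. Qed.

Let intKE : (\int[rho]_t expeR (H t) = K%:E)%E.
Proof.
rewrite fineK// ge0_fin_numE//; apply: integral_ge0 => t _; exact: expeR_ge0.
Qed.

Let K0 : 0 <= K.
Proof. by apply: fine_ge0; apply: integral_ge0 => t _; exact: expeR_ge0. Qed.

(** The estimate is effective when [A * L] is large: [H] exceeds [A] on an arc of
    length comparable to [L = A / n], whose mass is thus at most [K * exp (- A)].
    The half-length [L / 16] is small enough for the squared modulus of the polynomial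
    of [exists_arc_poly] to be at most [4 * exp (A / 2)] on that arc. *)
Lemma abs_lne_szego_min_ge_arc n (A : R) : (0 < n)%N -> 0 < A ->
  n%:R * longest_arc H A = A ->
  4 * (T + K) <= expR (A * longest_arc H A / 512) ->
  ((A * longest_arc H A / 1024)%:E <= `| lne (szego_min rho n)|)%E.
Proof.
move=> n0 A0; set L := longest_arc H A => nL hTK.
have nR0 : 0 < n%:R :> R by rewrite ltr0n.
have L0 : 0 < L by rewrite -(pmulr_rgt0 _ nR0) nL.
have [L1 [a [b [Lab Hab]]]] := longest_arc_witness L0; rewrite -/L in L1 Lab.
pose eta := L / 16; pose m := (a + b) / 2.
have eta_itv : 0 <= eta <= 2^-1 by apply/andP; split; rewrite /eta; lra.
have [p [pm sp p_all p_off]] := exists_arc_poly m n0 eta_itv.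
have pi4 : pi < 4 :> R by have := pihalf_lt2 R; lra.
have pi2 := pi_ge2 R.
have pe0 : 0 <= pi * eta by rewrite mulr_ge0 ?pi_ge0//; lra.
have pe4 : pi * eta <= 4 * eta by rewrite ler_wpM2r ?(ltW pi4)//; lra.
have pe2 : 2 * eta <= pi * eta by rewrite ler_wpM2r//; lra.
have s1 := sin_le_id pe0.
have s2 : pi * eta / 2 <= sin (pi * eta).
  by apply: sin_ge_half => //; rewrite /eta in pe4 *; lra.
have AL0 : 0 < A * L by rewrite mulr_gt0.
have ALA : A * L <= A by rewrite ler_piMr// ltW.
have s3 : 0 <= 1 + sin (pi * eta) by lra.
(* [n * eta = A / 16], since [n * L = A]. *)
have grow : ((1 + sin (pi * eta)) ^+ 2) ^+ n <= expR (A / 2).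
  apply: (@le_trans _ _ (expR (2 * (pi * eta)) ^+ n)).
    rewrite lerXn2r ?nnegrE ?expR_ge0 ?sqr_ge0// expRM_natl lerXn2r ?nnegrE ?expR_ge0//.
    by apply: (le_trans (expR_ge1Dx _)); rewrite ler_expR.
  rewrite -expRM_natl ler_expR.
  have : n%:R * (pi * eta) <= n%:R * (4 * eta) by rewrite ler_pM2l.
  have -> : n%:R * (4 * eta) = A / 4 by rewrite -nL /eta; field.
  lra.
have decay : (cos (pi * eta) ^+ 2) ^+ n <= expR (- (A * L / 256)).
  apply: (@le_trans _ _ (expR (- sin (pi * eta) ^+ 2) ^+ n)).
    rewrite lerXn2r ?nnegrE ?expR_ge0 ?sqr_ge0// cos2sin2 expR_ge1Dx//.
  rewrite -expRM_natl ler_expR mulrN lerN2.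
  have -> : A * L / 256 = n%:R * eta ^+ 2.
    by rewrite -{1}nL /eta; field.
  rewrite ler_pM2l// lerXn2r ?nnegrE; lra.
have y0 : 0 <= A * L / 1024 by lra.
have a0 : 0 <= 4 * expR (- (A * L / 256)) by rewrite mulr_ge0 ?expR_ge0.
have b0 : 0 <= 4 * expR (- (A / 2)) by rewrite mulr_ge0// expR_ge0.
apply: (abs_lne_szego_min_ge H0 Hlsc pm sp a0 b0 y0).
- move=> t; have [[x /= + <-]|tI] := pselect ((@expi R @` `]m - eta, m + eta[) t).
    rewrite in_itv/= => /andP[x1 x2].
    have /Hab AH : a < x < b by rewrite /m /eta in x1 x2; apply/andP; split; lra.
    rewrite (@le_trans _ _ ((4 * expR (- (A / 2)))%:E * (expR A)%:E)%E)//.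
      rewrite -EFinM lee_fin -mulrA -expRD (le_trans (p_all _))// ler_pM2l//.
      by rewrite (le_trans grow)// ler_expR; lra.
    rewrite (@le_trans _ _ ((4 * expR (- (A / 2)))%:E * expeR (H (expi x)))%E)//.
      rewrite lee_wpmul2l ?lee_fin ?mulr_ge0 ?expR_ge0//.
      by rewrite -[(expR A)%:E]/(expeR A%:E) lee_expeR ltW.
    by rewrite leeDr// lee_fin mulr_ge0// expR_ge0.
  rewrite (@le_trans _ _ (4 * expR (- (A * L / 256)))%:E)//.
    by rewrite lee_fin (le_trans (p_off _ tI))// ler_pM2l.
  by rewrite leeDl// mule_ge0 ?expeR_ge0// lee_fin mulr_ge0 ?expR_ge0.
rewrite rhoTE intKE -!EFinM -EFinD lee_fin.
apply: (@le_trans _ _ (expR (- (A * L / 256)) * (4 * (T + K)))).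
  have : expR (- (A / 2)) * K <= expR (- (A * L / 256)) * K.
    by rewrite ler_wpM2r// ler_expR; lra.
  lra.
apply: (@le_trans _ _ (expR (- (A * L / 256)) * expR (A * L / 512))).
  by rewrite ler_wpM2l ?expR_ge0.
by rewrite -expRD ler_expR; lra.
Qed.

(** If the integral of [H] diverges, [e_n] is at most [exp (- 1 / 2)] for large [n]. *)
Lemma abs_lne_szego_min_ge_half : (\int[@circle_leb R]_t H t = +oo)%E ->
  exists n0, forall n, (n0 <= n)%N -> ((2^-1)%:E <= `| lne (szego_min rho n)|)%E.
Proof.
move=> Hoo; have [k hk] := exists_lipschitz_env H0 Hlsc (4 + K) Hoo.
pose g := lipschitz_env H k; pose r : R := k.+1%:R.
have r0 : 0 < r by rewrite ltr0n.
have gr s t : g t - g s <= r * normc (circle_val s - circle_val t).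
  rewrite (le_trans (lipschitz_env_lipschitz H0 k s t))//.
  by rewrite ler_wpM2r ?normc_ge0// ler_nat.
have g0 t : 0 <= g t by exact: lipschitz_env_ge0.
have [N0 hN0] := exists_monic_le_exp (ltW r0) gr.
pose N := maxn N0 (Num.truncn (16 * r)).+1.
have [p [pm hp]] := hN0 N (leq_maxl _ _).
have Ngt : 16 * r < N%:R.
  by rewrite (lt_le_trans (truncnS_gt _))// ler_nat leq_maxr.
have NR0 : 0 < N%:R :> R by rewrite (le_lt_trans _ Ngt)// mulr_ge0// ltW.
have Npos : (0 < N)%N by rewrite -(ltr0n R).
have := lt_le_trans hk (integral_circle_le_riemann_sum Npos r0 g0 gr).
rewrite lte_fin; set mean := (\sum_(j < N) _) / _ in hp * => hmean.
(* The excess of [mean] over [K] absorbs the 2 of [exists_monic_le_exp], and leaves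
   [exp (- 1)] once [K] is bounded by [exp K]. *)
have {}hmean : 3 + K < mean.
  have : 16 * r / N%:R <= 1 by rewrite ler_pdivrMr// mul1r ltW.
  lra.
(* The same polynomial serves in all higher degrees, multiplied by a power of ['X],
   which is unimodular on the circle. *)
exists (size p).-1 => n pn.
have sp : size (p * 'X^(n - (size p).-1)) = n.+1.
  rewrite size_monicM// ?monicXn ?monic_neq0 ?monicXn// size_polyXn addnS/=.
  by rewrite -[size p]prednK ?size_poly_gt0 ?monic_neq0// addSn subnKC.
apply: (@abs_lne_szego_min_ge R rho H n (p * 'X^(n - (size p).-1))
  0 (expR (2 - mean))) => //.
- by rewrite monicMl// monicXn.
- move=> t; rewrite add0e hornerM hornerXn normcM normcX normc_circle expr1n mulr1.
  apply: (@le_trans _ _ (expR (g t + 2 - mean))%:E); first by rewrite lee_fin.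
  rewrite -addrA addrC expRD EFinM lee_wpmul2l// ?lee_fin ?expR_ge0//.
  by rewrite -[(expR _)%:E]/(expeR (g t)%:E) lee_expeR lipschitz_env_le_fun.
rewrite mul0e add0e intKE -EFinM lee_fin.
apply: (@le_trans _ _ (expR (2 - mean) * expR K)).
  rewrite ler_wpM2l ?expR_ge0//; have := expR_ge1Dx K; lra.
by rewrite -expRD ler_expR; lra.
Qed.

End lower_bounds.

Theorem theorem9 (R : realType) (H : circle R -> \bar R)
  (H_ge0 : forall t, (0 <= H t)%E)
  (H_lsc : lower_semicontinuous H)
  (H_int : (\int[@circle_leb R]_t H t = +oo)%E)
  (H_sol : forall C : R, 0 < C ->
     exists! A : R, 0 < A /\ C * longest_arc H A = A)
  (rho : {finite_measure set (circle R) -> \bar R})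
  (rho_H : (\int[rho]_t expeR (H t) < +oo)%E)
  (A : nat -> R)
  (A_sol : forall n, (1 <= n)%N ->
     0 < A n /\ n%:R * longest_arc H (A n) = A n) :
  exists c : R, 0 < c /\ exists n0 : nat, forall n, (n0 <= n)%N -> (1 <= n)%N ->
    ((c * A n * longest_arc H (A n))%:E <= `| lne (szego_min rho n) |)%E.
Proof.
have [n0 hn0] := abs_lne_szego_min_ge_half H_ge0 H_lsc rho_H H_int.
pose D : R := 4 * (fine (rho setT) + fine (\int[rho]_t expeR (H t))%E).
have D0 : 0 <= D.
  rewrite mulr_ge0// addr_ge0// fine_ge0//.
  by apply: integral_ge0 => t _; exact: expeR_ge0.
pose B := 512 * ln (1 + D).
have l0 : 0 <= ln (1 + D) by rewrite ln_ge0//; lra.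
have B0 : 0 <= B by rewrite /B; lra.
have c0 : 0 < (1024 * (B + 1))^-1 by rewrite invr_gt0; lra.
(* [c <= 1 / 1024] serves when [A * L >= B], and [c * B <= 1 / 2] when [A * L < B]. *)
exists (1024 * (B + 1))^-1; split => //; exists n0 => n n0n n1.
have [A0 nA] := A_sol n n1.
have AL0 : 0 <= A n * longest_arc H (A n).
  by rewrite mulr_ge0 ?ltW// -(pmulr_rgt0 _ (_ : 0 < n%:R)) ?ltr0n// nA.
rewrite -mulrA mulrC; have [AB|BA] := ltP (A n * longest_arc H (A n)) B.
  apply: le_trans (hn0 n n0n); rewrite lee_fin ler_pdivrMr; lra.
apply: le_trans (abs_lne_szego_min_ge_arc H_ge0 H_lsc rho_H n1 A0 nA _).
  rewrite lee_fin ler_pdivrMr; last by lra.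
  set y := A n * _.
  have -> : y / 1024 * (1024 * (B + 1)) = y * (B + 1) by field.
  by rewrite ler_peMr//; lra.
rewrite -/D (@le_trans _ _ (1 + D))//; first by lra.
rewrite -[leLHS]lnK ?posrE; last by lra.
by rewrite ler_expR; rewrite /B in BA; lra.
Qed.
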